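(* For all integers $d_1,d_2\ge 0$ the rational functions $I_{d_1,d_2}(z_1,z_2)$ satisfy $$I_{d_1,d_2}(z_1,z_2)=\sum_{n_1=0}^{d_1} \sum_{n_2=0}^{d_2}\frac{z_1^{-n_1}z_2^{-n_2}q^{n_1^2+n_2^2-n_1n_2}}{(q)_{d_1-n_1}(q)_{d_2-n_2}}\,I_{n_1,n_2}(z_1,z_2).$$
   Context: $(a)_n=\prod_{i=0}^{n-1}(1-aq^i)$, and for non-negative integers $d_1,d_2$ $$I_{d_1,d_2}(z_1,z_2)=\frac{(q z_1^{-1} z_2^{-1})_{d_1+d_2}}{(q)_{d_1} (q)_{d_2}(qz_1^{-1})_{d_1} (qz_2^{-1})_{d_2}(q z_1^{-1} z_2^{-1})_{d_1}(q z_1^{-1} z_2^{-1})_{d_2}},$$ a rational function in $q,z_1,z_2$. *)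

(* Defs.v *)
From mathcomp Require Import all_boot all_order all_algebra.
From mathcomp Require Import mpoly.

Set Implicit Arguments.
Unset Strict Implicit.
Unset Printing Implicit Defensive.

Import GRing.Theory.
Local Open Scope ring_scope.

(* The field K(q, z_1, z_2) of rational functions in three independent
   variables; variables 0, 1, 2 of the polynomial ring are q, z_1, z_2. *)
Definition ratfun (K : fieldType) : fieldType := {fraction {mpoly K[3]}}.

Definition ratvar (K : fieldType) (i : 'I_3) : ratfun K :=
  FracField.tofrac ('X_i : {mpoly K[3]}).

Definition rf_q (K : fieldType) : ratfun K := ratvar K (inord 0).
Definition rf_z1 (K : fieldType) : ratfun K := ratvar K (inord 1).
Definition rf_z2 (K : fieldType) : ratfun K := ratvar K (inord 2).

Definition qpoch (F : fieldType) (q a : F) (n : nat) : F :=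
  \prod_(0 <= i < n) (1 - a * q ^+ i).

Definition Ifun (F : fieldType) (q z1 z2 : F) (d1 d2 : nat) : F :=
  qpoch q (q * z1^-1 * z2^-1) (d1 + d2) /
  (qpoch q q d1 * qpoch q q d2 *
   qpoch q (q * z1^-1) d1 * qpoch q (q * z2^-1) d2 *
   qpoch q (q * z1^-1 * z2^-1) d1 * qpoch q (q * z1^-1 * z2^-1) d2).

(* Main.v *)
Require Import Defs.
From HB Require Import structures.
From mathcomp Require Import all_boot all_order all_algebra.
From mathcomp Require Import mpoly ring.

Set Implicit Arguments.
Unset Strict Implicit.
Unset Printing Implicit Defensive.

Import GRing.Theory.
Local Open Scope ring_scope.

(** Put x = 1/z1, y = 1/z2. The array I_{d1,d2} is the coefficient array of an
   eigenfunction of the q-difference Toda operator of type A2: with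
     E(d) = x q^d1 + q^(d2-d1) + 1/(y q^d2)
   it satisfies the three-term recursion
     (E(d) - E(0)) f(d) = q^(d2-d1) f(d1-1, d2) + 1/(y q^d2) f(d1, d2-1)
   (lemma [Ifun_toda]), which for the product formula of I is one polynomial
   identity in q^d1, q^d2, x, y. For generic parameters E(d) <> E(0) whenever
   d <> 0, so a solution is determined by its value at the origin
   ([toda_recursion_uniq]).

   The right-hand side of the claim is the image of I under the triangular
   transform with matrix
     M(d, n) = x^n1 y^n2 q^(n1^2 + n2^2 - n1 n2) / ((q)_{d1-n1} (q)_{d2-n2}).
   This transform commutes with the Toda operator. Indeed, moving a shift of f
   onto M by re-indexing the sum reduces the commutation to an identity between
   M(d, n) and its neighbours in n ([bailey_kernel_intertwines]), and all these
   neighbours are explicit multiples of M(d, n). Hence the transform maps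
   solutions of the recursion to solutions ([bailey_toda]); it also preserves
   the value at the origin, so it fixes every solution ([bailey_fixed]), in
   particular I.

   Genericity is needed only to know that some polynomials in q, z1, z2 do not
   vanish. This is seen by specializing them to K[X] with q = X and with z1, z2
   in {0, 1}, where each becomes, up to sign, 1, a power of X, or a difference
   of two distinct powers of X ([generic_of_injective]). *)

(** * Shifted arrays and their sums *)

(** The value 0 outside the quadrant makes the recursion below valid on its
   boundary as well. *)
Definition below1 (V : nmodType) (f : nat -> nat -> V) (d1 d2 : nat) : V :=
  if d1 is d.+1 then f d d2 else 0.

Definition below2 (V : nmodType) (f : nat -> nat -> V) (d1 d2 : nat) : V :=
  if d2 is d.+1 then f d1 d else 0.

(** Summation by re-indexing: the hypothesis kills the boundary term that would
   otherwise appear at the upper end. *)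
Lemma sum_below (R : pzRingType) (N : nat) (g : nat -> R) (f : nat -> R) :
  g N = 0 ->
  \sum_(0 <= n < N) g n * (if n is m.+1 then f m else 0) =
  \sum_(0 <= n < N) g n.+1 * f n.
Proof.
case: N => [|N] gN; first by rewrite !big_geq.
by rewrite big_nat_recl //= mulr0 add0r big_nat_recr //= gN mul0r addr0.
Qed.

Lemma sum_nat_widen0 (V : nmodType) (m n : nat) (f : nat -> V) :
  (m <= n)%N -> (forall i, (m <= i)%N -> f i = 0) ->
  \sum_(0 <= i < n) f i = \sum_(0 <= i < m) f i.
Proof.
move=> lemn f0; rewrite (big_cat_nat (n := m)) //= [X in _ + X]big_nat_cond.
by rewrite [X in _ + X]big1 ?addr0 // => i /andP[/andP[lemi _] _]; apply: f0.
Qed.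

(** * q-Pochhammer symbols and the neighbours of I *)

Lemma qpoch0 (F : fieldType) (q a : F) : qpoch q a 0 = 1.
Proof. by rewrite /qpoch big_geq. Qed.

Lemma qpochS (F : fieldType) (q a : F) (n : nat) :
  qpoch q (q * a) n.+1 = qpoch q (q * a) n * (1 - a * q ^+ n.+1).
Proof. by rewrite /qpoch big_nat_recr //= exprS mulrCA mulrA. Qed.

Lemma qpochqS (F : fieldType) (q : F) (n : nat) :
  qpoch q q n.+1 = qpoch q q n * (1 - q ^+ n.+1).
Proof. by have := qpochS q 1 n; rewrite mulr1 mul1r. Qed.

Lemma qpoch_neq0 (F : fieldType) (q a : F) (n : nat) :
  (forall k, 1 - a * q ^+ k.+1 != 0) -> qpoch q (q * a) n != 0.
Proof.
move=> a0; elim: n => [|n IHn]; first by rewrite qpoch0 oner_neq0.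
by rewrite qpochS mulf_neq0.
Qed.

(** What makes the denominators of I, and the factors 1 - q^(d1+d2)/(z1 z2)
   cleared in the recursion, invertible; the exponent 0 is included for the
   latter. *)
Definition nonresonant (F : fieldType) (q z1 z2 : F) : Prop :=
  [/\ forall k : nat, 1 - q ^+ k.+1 != 0,
      forall k : nat, 1 - z1^-1 * q ^+ k != 0,
      forall k : nat, 1 - z2^-1 * q ^+ k != 0
    & forall k : nat, 1 - z1^-1 * z2^-1 * q ^+ k != 0].

Lemma nonresonantC (F : fieldType) (q z1 z2 : F) :
  nonresonant q z1 z2 -> nonresonant q z2 z1.
Proof. by case=> gq g1 g2 g12; split=> // k; rewrite [z2^-1 * _]mulrC. Qed.

Lemma qpochq_neq0 (F : fieldType) (q z1 z2 : F) (n : nat) :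
  nonresonant q z1 z2 -> qpoch q q n != 0.
Proof.
case=> gq _ _ _; rewrite -[X in qpoch q X]mulr1; apply: qpoch_neq0 => k.
by rewrite mul1r.
Qed.

Lemma IfunC (F : fieldType) (q z1 z2 : F) (d1 d2 : nat) :
  Ifun q z1 z2 d1 d2 = Ifun q z2 z1 d2 d1.
Proof.
rewrite /Ifun addnC -!(mulrA q) [z1^-1 * _]mulrC; congr (_ / _); ring.
Qed.

(** Cross-multiplied ratio of two neighbouring values of I. For d1 = 0 the
   factor 1 - q^d1 vanishes, in agreement with the value 0 of [below1]. *)
Lemma below1_Ifun (F : fieldType) (q z1 z2 : F) (d1 d2 : nat) :
  nonresonant q z1 z2 ->
  below1 (Ifun q z1 z2) d1 d2 * (1 - z1^-1 * z2^-1 * q ^+ (d1 + d2)) =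
  Ifun q z1 z2 d1 d2 * ((1 - q ^+ d1) * (1 - z1^-1 * q ^+ d1)
     * (1 - z1^-1 * z2^-1 * q ^+ d1)).
Proof.
move=> gen; have [gq g1 g2 g12] := gen.
case: d1 => [|d1] /=; first by rewrite expr0 subrr !mul0r mulr0.
rewrite /Ifun addSn -!(mulrA q) !qpochS !qpochqS.
have Q1 := qpochq_neq0 d1 gen; have Q2 := qpochq_neq0 d2 gen.
have P1 := qpoch_neq0 d1 (fun k => g1 k.+1).
have P2 := qpoch_neq0 d2 (fun k => g2 k.+1).
have P3 := qpoch_neq0 d1 (fun k => g12 k.+1).
have P4 := qpoch_neq0 d2 (fun k => g12 k.+1).
move: (gq d1) (g1 d1.+1) (g12 d1.+1) Q1 Q2 P1 P2 P3 P4.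
set A := q ^+ d1.+1; set C := q ^+ (d1 + d2).+1.
move: (qpoch q q d1) (qpoch q q d2) (qpoch q (q * z1^-1) d1).
move: (qpoch q (q * z2^-1) d2) (qpoch q _ d1) (qpoch q _ d2) (qpoch q _ _).
move: (z1^-1) (z2^-1) A C => x y A C p1 p2 p3 p4 p5 p6 p7 *.
by field; do ?[apply/andP; split].
Qed.

Lemma below2_Ifun (F : fieldType) (q z1 z2 : F) (d1 d2 : nat) :
  nonresonant q z1 z2 ->
  below2 (Ifun q z1 z2) d1 d2 * (1 - z1^-1 * z2^-1 * q ^+ (d1 + d2)) =
  Ifun q z1 z2 d1 d2 * ((1 - q ^+ d2) * (1 - z2^-1 * q ^+ d2)
     * (1 - z1^-1 * z2^-1 * q ^+ d2)).
Proof.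
move=> /nonresonantC/(below1_Ifun d2 d1).
rewrite addnC IfunC [z2^-1 * z1^-1]mulrC => <-; congr (_ * _).
by case: d2 => //= d2; rewrite IfunC.
Qed.

(** * The Toda recursion *)

Section Toda.
Variables (F : fieldType) (q z1 z2 : F).

(** The weights 1/z1, 1, z2 of the three exponentials are forced, up to a common
   factor, by the cancellations in [bailey_kernel_intertwines]. *)
Definition toda_eigenvalue (d1 d2 : nat) : F :=
  z1^-1 * q ^+ d1 + q ^+ d2 / q ^+ d1 + z2 / q ^+ d2.

Definition toda_recursion (f : nat -> nat -> F) : Prop :=
  forall d1 d2 : nat,
  (toda_eigenvalue d1 d2 - toda_eigenvalue 0 0) * f d1 d2 =
  q ^+ d2 / q ^+ d1 * below1 f d1 d2 + z2 / q ^+ d2 * below2 f d1 d2.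

Definition generic : Prop :=
  [/\ [/\ q != 0, z1 != 0 & z2 != 0], nonresonant q z1 z2
    & forall d1 d2 : nat, (0 < d1 + d2)%N ->
        toda_eigenvalue d1 d2 - toda_eigenvalue 0 0 != 0].

Hypothesis gen : generic.

Let q0 : q != 0. Proof. by case: gen => [[]]. Qed.
Let z10 : z1 != 0. Proof. by case: gen => [[]]. Qed.
Let z20 : z2 != 0. Proof. by case: gen => [[]]. Qed.
Let qn0 n : q ^+ n != 0. Proof. exact: expf_neq0. Qed.

(** The recursion expresses f at d <> 0 through values of smaller d1 + d2,
   because the coefficient of f d1 d2 is invertible by genericity. *)
Lemma toda_recursion_uniq (f g : nat -> nat -> F) :
  toda_recursion f -> toda_recursion g -> f 0%N 0%N = g 0%N 0%N ->
  forall d1 d2 : nat, f d1 d2 = g d1 d2.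
Proof.
move=> fP gP fg0 d1 d2; have [n] := ubnP (d1 + d2).
elim: n d1 d2 => // n IHn d1 d2; rewrite ltnS => len.
have [d0|dpos] := posnP (d1 + d2).
  by move/eqP: d0; rewrite addn_eq0 => /andP[/eqP-> /eqP->].
have [_ _ /(_ d1 d2 dpos) Ene0] := gen; apply: (mulfI Ene0); rewrite fP gP.
congr (_ * _ + _ * _).
  by case: d1 len {dpos Ene0} => //= d1 len; apply: IHn.
by case: d2 len {dpos Ene0} => //= d2; rewrite addnS => len; apply: IHn.
Qed.

Lemma Ifun_toda : toda_recursion (Ifun q z1 z2).
Proof.
move=> d1 d2; have [_ nr _] := gen; have [_ _ _ g12] := nr.
(* Clearing 1 - q^(d1+d2)/(z1 z2) makes both lower neighbours of I polynomial
   multiples of I at d, so that a rational identity in q^d1, q^d2 remains. *)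
apply: (mulIf (g12 (d1 + d2)%N)).
rewrite [RHS]mulrDl -2!(mulrA (_ / _)).
rewrite (below1_Ifun _ _ nr) (below2_Ifun _ _ nr).
rewrite /toda_eigenvalue !expr0 exprD.
have := qn0 d1; have := qn0 d2; move: (q ^+ d1) (q ^+ d2) => A B B0 A0.
by field; rewrite z20 z10 B0 A0 oner_neq0.
Qed.

(** * The transform *)

Definition bailey_weight (n1 n2 : nat) : F :=
  z1 ^- n1 * z2 ^- n2 * q ^ (n1%:Z ^+ 2 + n2%:Z ^+ 2 - n1%:Z * n2%:Z).

Lemma bailey_weightS1 (n1 n2 : nat) :
  bailey_weight n1.+1 n2 =
  bailey_weight n1 n2 * (z1^-1 * q * q ^+ n1 ^+ 2 / q ^+ n2).
Proof.
rewrite /bailey_weight.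
have -> : (n1.+1%:Z ^+ 2 + n2%:Z ^+ 2 - n1.+1%:Z * n2%:Z =
  (n1%:Z ^+ 2 + n2%:Z ^+ 2 - n1%:Z * n2%:Z) + (1 + n1%:Z + n1%:Z) - n2%:Z)%R.
  by rewrite intS; ring.
rewrite !expfzDr // -exprnN expr1z -!exprnP exprS invfM expr2; ring.
Qed.

Lemma bailey_weightS2 (n1 n2 : nat) :
  bailey_weight n1 n2.+1 =
  bailey_weight n1 n2 * (z2^-1 * q * q ^+ n2 ^+ 2 / q ^+ n1).
Proof.
rewrite /bailey_weight.
have -> : (n1%:Z ^+ 2 + n2.+1%:Z ^+ 2 - n1%:Z * n2.+1%:Z =
  (n1%:Z ^+ 2 + n2%:Z ^+ 2 - n1%:Z * n2%:Z) + (1 + n2%:Z + n2%:Z) - n1%:Z)%R.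
  by rewrite intS; ring.
rewrite !expfzDr // -exprnN expr1z -!exprnP exprS invfM expr2; ring.
Qed.

(** Extended by 0 to n > d, so that [bailey_kernelS] holds for all d and n and
   sums over n may be taken over any sufficiently long range. *)
Definition bailey_kernel (d n : nat) : F :=
  if (n <= d)%N then (qpoch q q (d - n))^-1 else 0.

Lemma bailey_kernel_out (d n : nat) : (d < n)%N -> bailey_kernel d n = 0.
Proof. by rewrite /bailey_kernel ltnNge => /negbTE->. Qed.

(** Raising n and lowering d act on 1/(q)_{d-n} in the same way; this is why a
   single factor governs both sides of [bailey_kernel_intertwines]. At n = d the
   factor vanishes, as the extension by 0 requires. *)
Lemma bailey_kernelS (d n : nat) :
  bailey_kernel d n.+1 = bailey_kernel d n * (1 - q ^+ d / q ^+ n).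
Proof.
have [ltnd|ltdn|->] := ltngtP n d; last first.
- by rewrite bailey_kernel_out // divff // subrr mulr0.
- by rewrite !bailey_kernel_out ?mul0r // ltnS ltnW.
have [_ [gq _ _ _] _] := gen.
rewrite /bailey_kernel ltnd (ltnW ltnd) -expfB // -(subnSK ltnd).
by rewrite qpochqS invfM mulfVK.
Qed.

(** The range N does not depend on d, so that the values at d and at its lower
   neighbours are sums over one index set; see [bailey_widen]. *)
Definition bailey_transform (N : nat) (f : nat -> nat -> F) (d1 d2 : nat) : F :=
  \sum_(0 <= n1 < N) \sum_(0 <= n2 < N)
    bailey_kernel d1 n1 * bailey_kernel d2 n2 * bailey_weight n1 n2 * f n1 n2.

Lemma below1_bailey (N : nat) (f : nat -> nat -> F) (d1 d2 : nat) :
  below1 (bailey_transform N f) d1 d2 =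
  \sum_(0 <= n1 < N) \sum_(0 <= n2 < N)
    bailey_kernel d1 n1.+1 * bailey_kernel d2 n2 * bailey_weight n1 n2 *
    f n1 n2.
Proof.
case: d1 => [|d1] //=.
rewrite big1 // => n1 _; rewrite big1 // => n2 _.
by rewrite bailey_kernel_out ?mul0r.
Qed.

Lemma below2_bailey (N : nat) (f : nat -> nat -> F) (d1 d2 : nat) :
  below2 (bailey_transform N f) d1 d2 =
  \sum_(0 <= n1 < N) \sum_(0 <= n2 < N)
    bailey_kernel d1 n1 * bailey_kernel d2 n2.+1 * bailey_weight n1 n2 *
    f n1 n2.
Proof.
case: d2 => [|d2] //=; rewrite big1 // => n1 _; rewrite big1 // => n2 _.
by rewrite [bailey_kernel 0 _]bailey_kernel_out // mulr0 !mul0r.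
Qed.

(** The Toda operator acting on M in the variable n, by the adjoint of the
   recursion, agrees with its action in the variable d. Once the
   common factor M(d, n) is taken out, both sides are Laurent polynomials in
   q^d1, q^d2, q^n1, q^n2: for instance the term with [n1.+1] on the left becomes
   (q^n1 - q^d1)/z1 and cancels the first summand of the eigenvalue
   difference. *)
Lemma bailey_kernel_intertwines (d1 d2 n1 n2 : nat) :
  (toda_eigenvalue d1 d2 - toda_eigenvalue n1 n2) *
    (bailey_kernel d1 n1 * bailey_kernel d2 n2 * bailey_weight n1 n2) +
  q ^+ n2 / q ^+ n1.+1 *
    (bailey_kernel d1 n1.+1 * bailey_kernel d2 n2 * bailey_weight n1.+1 n2) +
  z2 / q ^+ n2.+1 *
    (bailey_kernel d1 n1 * bailey_kernel d2 n2.+1 * bailey_weight n1 n2.+1) =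
  q ^+ d2 / q ^+ d1 *
    (bailey_kernel d1 n1.+1 * bailey_kernel d2 n2 * bailey_weight n1 n2) +
  z2 / q ^+ d2 *
    (bailey_kernel d1 n1 * bailey_kernel d2 n2.+1 * bailey_weight n1 n2).
Proof.
rewrite !bailey_kernelS bailey_weightS1 bailey_weightS2 /toda_eigenvalue !exprS.
move: (qn0 d1) (qn0 d2) (qn0 n1) (qn0 n2).
move: (q ^+ d1) (q ^+ d2) (q ^+ n1) (q ^+ n2) => A B C D A0 B0 C0 D0.
by field; rewrite q0 z10 z20 A0 B0 C0 D0.
Qed.

(** Write E(d) - E(0) as (E(d) - E(n)) + (E(n) - E(0)) under the sum, expand the
   second part by the recursion for f, and move the resulting shifts of f onto
   the kernel; what remains is [bailey_kernel_intertwines] term by term. *)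
Lemma bailey_toda (N : nat) (f : nat -> nat -> F) (d1 d2 : nat) :
  (d1 < N)%N -> (d2 < N)%N -> toda_recursion f ->
  (toda_eigenvalue d1 d2 - toda_eigenvalue 0 0) * bailey_transform N f d1 d2 =
  q ^+ d2 / q ^+ d1 * below1 (bailey_transform N f) d1 d2 +
  z2 / q ^+ d2 * below2 (bailey_transform N f) d1 d2.
Proof.
move=> ltd1 ltd2 fP; rewrite below1_bailey below2_bailey.
pose K n1 n2 := bailey_kernel d1 n1 * bailey_kernel d2 n2 * bailey_weight n1 n2.
have shift1 : \sum_(0 <= n1 < N) \sum_(0 <= n2 < N)
    q ^+ n2 / q ^+ n1 * K n1 n2 * below1 f n1 n2 =
  \sum_(0 <= n1 < N) \sum_(0 <= n2 < N)
    q ^+ n2 / q ^+ n1.+1 * K n1.+1 n2 * f n1 n2.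
  rewrite exchange_big [RHS]exchange_big; apply: eq_bigr => n2 _.
  apply: (sum_below (g := fun n1 => q ^+ n2 / q ^+ n1 * K n1 n2)
                    (fun n1 => f n1 n2)).
  by rewrite /K bailey_kernel_out // !mul0r mulr0.
have shift2 : \sum_(0 <= n1 < N) \sum_(0 <= n2 < N)
    z2 / q ^+ n2 * K n1 n2 * below2 f n1 n2 =
  \sum_(0 <= n1 < N) \sum_(0 <= n2 < N)
    z2 / q ^+ n2.+1 * K n1 n2.+1 * f n1 n2.
  apply: eq_bigr => n1 _.
  apply: (sum_below (g := fun n2 => z2 / q ^+ n2 * K n1 n2)).
  by rewrite /K [bailey_kernel d2 N]bailey_kernel_out // mulr0 mul0r mulr0.
transitivity (\sum_(0 <= n1 < N) \sum_(0 <= n2 < N)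
   ((toda_eigenvalue d1 d2 - toda_eigenvalue n1 n2) * K n1 n2 * f n1 n2 +
    q ^+ n2 / q ^+ n1 * K n1 n2 * below1 f n1 n2 +
    z2 / q ^+ n2 * K n1 n2 * below2 f n1 n2)).
  rewrite mulr_sumr; apply: eq_bigr => n1 _; rewrite mulr_sumr.
  apply: eq_bigr => n2 _; rewrite -/(K n1 n2) -[RHS]addrA.
  transitivity ((toda_eigenvalue d1 d2 - toda_eigenvalue n1 n2) * K n1 n2
    * f n1 n2 + K n1 n2 * ((toda_eigenvalue n1 n2 - toda_eigenvalue 0 0)
    * f n1 n2)); first by ring.
  by rewrite fP; ring.
do 2 under eq_bigr do rewrite big_split /=.
rewrite !big_split /= shift1 shift2 !mulr_sumr -!big_split /=.
apply: eq_bigr => n1 _; rewrite !mulr_sumr -!big_split /=.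
apply: eq_bigr => n2 _; rewrite -!mulrDl bailey_kernel_intertwines; ring.
Qed.

Lemma bailey_widen (N d1 d2 : nat) (f : nat -> nat -> F) :
  (d1 < N)%N -> (d2 < N)%N ->
  bailey_transform N f d1 d2 =
  \sum_(0 <= n1 < d1.+1) \sum_(0 <= n2 < d2.+1)
    bailey_kernel d1 n1 * bailey_kernel d2 n2 * bailey_weight n1 n2 * f n1 n2.
Proof.
move=> ltd1 ltd2; rewrite /bailey_transform (sum_nat_widen0 ltd1) => [|n1 ltn1].
  apply: eq_bigr => n1 _; apply: (sum_nat_widen0 ltd2) => n2 ltn2.
  by rewrite [bailey_kernel d2 _]bailey_kernel_out // mulr0 !mul0r.
by apply: big1 => n2 _; rewrite bailey_kernel_out // !mul0r.
Qed.

(** The transform of a solution is a solution with the same value at the origin,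
   where its sum has the single term with kernel and weight 1. *)
Theorem bailey_fixed (f : nat -> nat -> F) (d1 d2 : nat) :
  toda_recursion f ->
  f d1 d2 = \sum_(0 <= n1 < d1.+1) \sum_(0 <= n2 < d2.+1)
    bailey_kernel d1 n1 * bailey_kernel d2 n2 * bailey_weight n1 n2 * f n1 n2.
Proof.
move=> fP; pose g e1 e2 := bailey_transform (e1 + e2).+1 f e1 e2.
have gE N e1 e2 :
    (e1 < N)%N -> (e2 < N)%N -> bailey_transform N f e1 e2 = g e1 e2.
  by move=> lt1 lt2; rewrite /g !bailey_widen // ltnS ?leq_addr ?leq_addl.
rewrite -(@bailey_widen (d1 + d2).+1) ?ltnS ?leq_addr ?leq_addl //.
apply: (toda_recursion_uniq (g := g)) => // [e1 e2|].
  rewrite /g bailey_toda ?ltnS ?leq_addr ?leq_addl //.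
  congr (_ * _ + _ * _).
    case: e1 => //= e1; rewrite gE // ltnS ?leq_addl //.
    by rewrite (leq_trans (leqnSn _)) ?leq_addr.
  case: e2 => //= e2; rewrite gE // ltnS ?leq_addr //.
  by rewrite (leq_trans (leqnSn _)) ?leq_addl.
rewrite /g /bailey_transform !big_nat1 /bailey_kernel /bailey_weight /=.
rewrite qpoch0 invr1.
have -> : 0%:Z ^+ 2 + 0%:Z ^+ 2 - 0%:Z * 0%:Z = 0 by [].
by rewrite expr0z !mul1r.
Qed.

End Toda.

(** * Genericity of independent variables *)

(** The variable q stays free: powers of q then remain distinct over every field
   K, including finite ones, where a specialization with values in K would
   identify some of them. *)
Definition specialize (K : fieldType) (c1 c2 : K) (P : {mpoly K[3]}) :
  {poly K} := mmap polyC (fun i => nth 0 [:: 'X; c1%:P; c2%:P] i) P.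

HB.instance Definition _ (K : fieldType) (c1 c2 : K) :=
  GRing.RMorphism.copy (specialize c1 c2)
    (mmap polyC (fun i : 'I_3 => nth 0 [:: 'X; c1%:P; c2%:P] i)).

Lemma specialize_var (K : fieldType) (c1 c2 : K) :
  (specialize c1 c2 'X_(inord 0) = 'X) *
  (specialize c1 c2 'X_(inord 1) = c1%:P) *
  (specialize c1 c2 'X_(inord 2) = c2%:P).
Proof. by split; [split|]; rewrite /specialize mmapX mmap1U inordK. Qed.

Definition rmorphE := (rmorphB, rmorphD, rmorphM, rmorphXn, rmorph1).

Lemma polyXn_subr_neq0 (K : fieldType) (m n : nat) :
  m != n -> 'X^m - 'X^n != 0 :> {poly K}.
Proof.
apply: contraNN; rewrite subr_eq0 => /eqP/(congr1 (fun p : {poly K} => size p)).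
by rewrite !size_polyXn => -[->].
Qed.

(** Each condition says that an element of F is nonzero; up to an invertible
   monomial it is the image of a polynomial whose specialization is nonzero. *)
Lemma generic_of_injective (K F : fieldType)
    (e : {rmorphism {mpoly K[3]} -> F}) :
  (forall P, e P = 0 -> P = 0) ->
  generic (e 'X_(inord 0)) (e 'X_(inord 1)) (e 'X_(inord 2)).
Proof.
move=> e_inj.
have e_neq0 c1 c2 P : specialize c1 c2 P != 0 -> e P != 0.
  by apply: contraNneq => /e_inj->; rewrite rmorph0.
set X0 := 'X_(inord 0); set X1 := 'X_(inord 1); set X2 := 'X_(inord 2).
have q0 : e X0 != 0 by apply: (e_neq0 0 0); rewrite specialize_var polyX_eq0.
have z10 : e X1 != 0.
  by apply: (e_neq0 1 0); rewrite specialize_var oner_neq0.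
have z20 : e X2 != 0.
  by apply: (e_neq0 0 1); rewrite specialize_var oner_neq0.
have clear a b k P : a != 0 -> a * (1 - b * e X0 ^+ k) = e P ->
    specialize 0 0 P != 0 -> 1 - b * e X0 ^+ k != 0.
  by move=> a0 aE /e_neq0; rewrite -aE mulf_eq0 (negbTE a0).
split; [by split| |move=> d1 d2 dpos].
  split=> k.
  - rewrite -[X in 1 - X]mul1r.
    apply: (clear 1 1 k.+1 (1 - X0 ^+ k.+1)); first exact: oner_neq0.
      by rewrite !mul1r !rmorphE.
    rewrite !rmorphE /= specialize_var; exact: (polyXn_subr_neq0 K (m := 0)).
  - apply: (clear (e X1) _ k (X1 - X0 ^+ k)) => //.
      by rewrite mulrBr mulr1 mulVKf // !rmorphE.
    by rewrite !rmorphE /= !specialize_var sub0r oppr_eq0 monic_neq0 ?monicXn.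
  - apply: (clear (e X2) _ k (X2 - X0 ^+ k)) => //.
      by rewrite mulrBr mulr1 mulVKf // !rmorphE.
    by rewrite !rmorphE /= !specialize_var sub0r oppr_eq0 monic_neq0 ?monicXn.
  - apply: (clear (e X1 * e X2) _ k (X1 * X2 - X0 ^+ k)).
    + by rewrite mulf_neq0.
    + by rewrite mulrBr mulr1 -invfM mulVKf ?mulf_neq0 // !rmorphE.
    + rewrite !rmorphE /= !specialize_var mulr0 sub0r oppr_eq0.
      by rewrite monic_neq0 ?monicXn.
(* The eigenvalue difference multiplied by z1 q^(d1+d2). Setting z1 = 0 leaves
   X^(2 d1 + d2) - X^(d1 + d2), nonzero if d1 > 0; if d1 = 0, setting z1 = 1 and
   z2 = 0 leaves X^(2 d2) - X^d2. *)
pose P := X0 ^+ (d1 + d1 + d2) + X1 * X0 ^+ (d2 + d2) + X1 * X2 * X0 ^+ d1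
  - (1 + X1 + X1 * X2) * X0 ^+ (d1 + d2).
have PE : (toda_eigenvalue (e X0) (e X1) (e X2) d1 d2 -
    toda_eigenvalue (e X0) (e X1) (e X2) 0 0) *
    (e X1 * e X0 ^+ d1 * e X0 ^+ d2) = e P.
  rewrite /P !rmorphE /toda_eigenvalue !expr0 !exprD.
  have := expf_neq0 d1 q0; have := expf_neq0 d2 q0; move: z10.
  move: (e X1) (e X2) (_ ^+ d1) (_ ^+ d2) => x y A B x0 B0 A0.
  by field; rewrite x0 B0 A0 oner_neq0.
suff P0 : e P != 0 by apply: contraNneq P0 => E0; rewrite -PE E0 mul0r.
have [d10|d1pos] := posnP d1.
  apply: (e_neq0 1 0); rewrite !rmorphE /= !specialize_var d10 !mul1r.
  rewrite !(mul0r, add0n, addr0) mulrDl !mul1r opprD addrACA subrr add0r.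
  rewrite polyXn_subr_neq0 // -{3}[d2]addn0 eqn_add2l -lt0n.
  by move: dpos; rewrite d10.
apply: (e_neq0 0 0); rewrite !rmorphE /= !specialize_var.
rewrite !(mul0r, addr0) mul1r.
by rewrite polyXn_subr_neq0 // eqn_add2r -{3}[d1]addn0 eqn_add2l -lt0n.
Qed.

Lemma generic_ratfun (K : fieldType) : generic (rf_q K) (rf_z1 K) (rf_z2 K).
Proof.
apply: (@generic_of_injective K (ratfun K) (@FracField.tofrac {mpoly K[3]})).
by move=> P /eqP; rewrite tofrac_eq0 => /eqP.
Qed.

Theorem corollary7p9 (K : fieldType) (d1 d2 : nat) :
  let q := rf_q K in
  let z1 := rf_z1 K in
  let z2 := rf_z2 K in
  Ifun q z1 z2 d1 d2 =
  \sum_(0 <= n1 < d1.+1) \sum_(0 <= n2 < d2.+1)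
    (z1 ^- n1 * z2 ^- n2 * q ^ (n1%:Z ^+ 2 + n2%:Z ^+ 2 - n1%:Z * n2%:Z)) /
    (qpoch q q (d1 - n1) * qpoch q q (d2 - n2)) * Ifun q z1 z2 n1 n2.
Proof.
move=> q z1 z2; have gen := generic_ratfun K.
rewrite [LHS](bailey_fixed gen _ _ (Ifun_toda gen)).
apply: eq_big_nat => n1 /andP[_ le1]; apply: eq_big_nat => n2 /andP[_ le2].
by rewrite /bailey_kernel -ltnS le1 -ltnS le2 [(qpoch _ _ _ * _)^-1]invfM
  [X in X * _ = _]mulrC.
Qed.
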